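(* Let $1<p<p_0<\infty$ and let $f,g$ be nonnegative sequences on $\mathbb{Z}_+$. Assume there is a positive increasing function $\varphi_{p_0}$ on $[1,\infty)$ such that for every $w_0\in\mathcal{A}_{p_0}$, $$\Big(\sum_{k=1}^\infty w_0(k)f(k)^{p_0}\Big)^{1/p_0}\le\varphi_{p_0}\big([w_0]_{\mathcal{A}_{p_0}}\big)\Big(\sum_{k=1}^\infty w_0(k)g(k)^{p_0}\Big)^{1/p_0}.$$ Then for every $w\in\mathcal{A}_p$ with $f\in\ell^p(w)$, $$\Big(\sum_{k=1}^\infty w(k)f(k)^{p}\Big)^{1/p}\le 2^{\frac{p_0-p}{p_0}}\,\varphi_{p_0}\Big(\big(2\|\mathcal{M}\|_{\ell^p(w)}\big)^{p_0-p}[w]_{\mathcal{A}_p}\Big)\Big(\sum_{k=1}^\infty w(k)g(k)^{p}\Big)^{1/p}.$$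
   Context: Throughout, a weight is a sequence $w=\{w(k)\}_{k\ge 1}$ of strictly positive real numbers indexed by $\mathbb{Z}_+=\{1,2,\dots\}$. For $1\le q<\infty$ and a weight $v$, $\ell^q(v)$ is the space of real sequences $f$ with $\|f\|_{\ell^q(v)}=\big(\sum_{k\ge1}v(k)|f(k)|^q\big)^{1/q}<\infty$. The discrete Hardy–Littlewood maximal operator is $\mathcal{M}f(k)=\sup_{n\ge k}\frac1n\sum_{j=1}^n|f(j)|$, $k\in\mathbb{Z}_+$. For $1<q<\infty$, a weight $w$ belongs to $\mathcal{A}_q$ iff $[w]_{\mathcal{A}_q}:=\sup_{n\ge1}\big(\frac1n\sum_{k=1}^n w(k)\big)\big(\frac1n\sum_{k=1}^n w(k)^{-1/(q-1)}\big)^{q-1}<\infty$. $\|\mathcal{M}\|_{\ell^q(v)}$ denotes the operator norm $\sup\{\|\mathcal{M}f\|_{\ell^q(v)}:\|f\|_{\ell^q(v)}\le1\}$; it is known to be finite when $v\in\mathcal{A}_q$. *)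

(* Defs.v *)
From HB Require Import structures.
From mathcomp Require Import all_boot all_order all_algebra.
From mathcomp Require Import all_classical all_reals all_analysis.
Set Implicit Arguments. Unset Strict Implicit. Unset Printing Implicit Defensive.
Import Order.TTheory GRing.Theory Num.Theory.
Local Open Scope ring_scope.

(* Sequences are functions nat -> R; only the indices k >= 1 (i.e. Z_+) matter. *)

Definition weight (R : realType) (w : nat -> R) : Prop :=
  forall k : nat, (1 <= k)%N -> 0 < w k.

Definition avg (R : realType) (u : nat -> R) (n : nat) : R :=
  n%:R^-1 * \sum_(1 <= k < n.+1) u k.

Definition Ap_const (R : realType) (q : R) (w : nat -> R) : \bar R :=
  ereal_sup [set ((avg w n) *
                  (avg (fun k => w k `^ (- (q - 1)^-1)) n) `^ (q - 1))%:E
            | n in [set n : nat | (1 <= n)%N]].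

Definition inAp (R : realType) (q : R) (w : nat -> R) : Prop :=
  weight w /\ (Ap_const q w < +oo)%E.

(* [w]_{A_q} as a real number (meaningful when w \in A_q) *)
Definition Apc (R : realType) (q : R) (w : nat -> R) : R := fine (Ap_const q w).

Definition lpnormE (R : realType) (q : R) (v : nat -> R) (F : nat -> \bar R)
  : \bar R :=
  poweR (\sum_(1 <= k <oo) ((v k)%:E * poweR (`|F k|)%E q))%E q^-1.

Definition lpnorm (R : realType) (q : R) (v : nat -> R) (f : nat -> R) : \bar R :=
  lpnormE q v (fun k => (f k)%:E).

Definition maxop (R : realType) (f : nat -> R) (k : nat) : \bar R :=
  ereal_sup [set (avg (fun j => `|f j|) n)%:E
            | n in [set n : nat | (1 <= n)%N && (k <= n)%N]].

Definition opnormM (R : realType) (q : R) (v : nat -> R) : \bar R :=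
  ereal_sup [set lpnormE q v (maxop f)
            | f in [set f : nat -> R | (lpnorm q v f <= 1)%E]].

(* Main.v *)
(** Take the Rubio de Francia majorant v = \sum_i (M^i g) / (2N)^i, with N the
    norm of M on l^p(w). Then g <= v, |v| <= 2 |g| and M v <= 2N v, so that
    w0 = w v^(p - p0) is in A_p0 with constant at most (2N)^(p0 - p) [w].
    Hoelder's inequality bounds |f| in l^p(w) by |f| in l^p0(w0) times
    |v|^((p0 - p) / p0), the hypothesis replaces f by g, and g <= v returns
    from l^p0(w0) to l^p(w). If g = 0, the same is run on a point mass.

    Finiteness of N is Muckenhoupt's theorem: following Lerner, M is controlled
    by two maximal operators with respect to measures, which are bounded with
    no condition on the measure, by a deterministic form of Doob's inequality. *)
Require Import Defs.
From HB Require Import structures.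
From mathcomp Require Import all_boot all_order all_algebra.
From mathcomp Require Import all_classical all_reals all_analysis.
From mathcomp Require Import ring lra.
Set Implicit Arguments. Unset Strict Implicit. Unset Printing Implicit Defensive.
Import Order.TTheory GRing.Theory Num.Theory.
Import numFieldNormedType.Exports.
Local Open Scope ring_scope.

(** * Young's and Hoelder's inequalities for real powers *)

Lemma young_powR (R : realType) (t a b : R) : 0 < t -> t < 1 -> 0 <= a -> 0 <= b ->
  a `^ t * b `^ (1 - t) <= t * a + (1 - t) * b.
Proof.
move=> t0 t1 a0 b0.
have t1' : 0 < 1 - t by rewrite subr_gt0.
have := @conjugate_powR R (a `^ t) (b `^ (1 - t)) t^-1 (1 - t)^-1
  (powR_ge0 _ _) (powR_ge0 _ _).
rewrite !invr_gt0 !invrK => /(_ t0 t1'); rewrite -!powRrM.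
rewrite !mulfV ?gt_eqF// !powRr1// (mulrC a) (mulrC b); apply.
by rewrite addrC subrK.
Qed.

Lemma le_powR_base (R : realType) (r x y : R) : 0 <= r -> 0 <= x -> x <= y ->
  x `^ r <= y `^ r.
Proof.
move=> r0 x0 xy; apply: ge0_ler_powR => //; rewrite nnegrE//.
exact: le_trans xy.
Qed.

Lemma powRK (R : realType) (r x : R) : r != 0 -> 0 <= x -> (x `^ r) `^ r^-1 = x.
Proof. by move=> r0 x0; rewrite -powRrM mulfV// powRr1. Qed.

Lemma powRVK (R : realType) (r x : R) : r != 0 -> 0 <= x -> (x `^ r^-1) `^ r = x.
Proof. by move=> r0 x0; rewrite -powRrM mulVf// powRr1. Qed.

(** Normalising by the two sums reduces the claim to [young_powR] termwise, the right sides adding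
    up to [t + (1 - t) = 1]. A zero sum has only zero terms and is treated apart. *)
Lemma hoelder_sum (R : realType) (I : eqType) (r : seq I) (a b : I -> R) (t : R) :
  0 < t -> t < 1 -> {in r, forall i, 0 <= a i} -> {in r, forall i, 0 <= b i} ->
  \sum_(i <- r) a i `^ t * b i `^ (1 - t) <=
    (\sum_(i <- r) a i) `^ t * (\sum_(i <- r) b i) `^ (1 - t).
Proof.
move=> t0 t1 a0 b0.
have t1' : 0 < 1 - t by rewrite subr_gt0.
set A := \sum_(i <- r) a i; set B := \sum_(i <- r) b i.
have A0 : 0 <= A by rewrite /A big_seq sumr_ge0.
have B0 : 0 <= B by rewrite /B big_seq sumr_ge0.
have sum0 (c : I -> R) : {in r, forall i, 0 <= c i} -> \sum_(i <- r) c i = 0 ->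
    {in r, forall i, c i = 0}.
  move=> c0; rewrite big_seq => /eqP; rewrite psumr_eq0//= => /allP h i ir.
  by apply/eqP/(implyP (h i ir)).
have [AE|Apos] := eqVneq A 0.
  rewrite AE powR0 ?gt_eqF// mul0r big_seq big1// => i ir.
  by rewrite (sum0 a)// powR0 ?gt_eqF// mul0r.
have [BE|Bpos] := eqVneq B 0.
  rewrite BE powR0 ?gt_eqF// mulr0 big_seq big1// => i ir.
  by rewrite (sum0 b)// powR0 ?gt_eqF// mulr0.
have {Apos}Apos : 0 < A by rewrite lt_neqAle eq_sym Apos.
have {Bpos}Bpos : 0 < B by rewrite lt_neqAle eq_sym Bpos.
have step i : i \in r -> a i `^ t * b i `^ (1 - t) <=
    A `^ t * B `^ (1 - t) * (t * (a i / A) + (1 - t) * (b i / B)).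
  move=> ir.
  have ai := a0 i ir; have bi := b0 i ir.
  have -> : a i `^ t = (a i / A) `^ t * A `^ t.
    by rewrite -powRM ?divr_ge0// divfK ?gt_eqF.
  have -> : b i `^ (1 - t) = (b i / B) `^ (1 - t) * B `^ (1 - t).
    by rewrite -powRM ?divr_ge0// divfK ?gt_eqF.
  rewrite mulrACA mulrC ler_wpM2l ?mulr_ge0 ?powR_ge0//.
  by apply: young_powR; rewrite ?divr_ge0.
rewrite big_seq; apply: le_trans (ler_sum _ step) _.
rewrite -big_seq -mulr_sumr big_split/= -!mulr_sumr -!mulr_suml -/A -/B.
by rewrite !divff ?gt_eqF// !mulr1 [t + _]addrC subrK mulr1.
Qed.

(* Young's inequality for [x * y^(q-1)]. *)
Lemma powR_diff_le (R : realType) (q x y : R) : 1 < q -> 0 <= x -> 0 <= y ->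
  (1 - q^-1) * (x `^ q - y `^ q) <= x * (x `^ (q - 1) - y `^ (q - 1)).
Proof.
move=> q1 x0 y0; have q0 : 0 < q by exact: lt_trans q1.
rewrite [x * (_ - _)]mulrBr mulr_powRB1//.
have := @young_powR R q^-1 (x `^ q) (y `^ q).
rewrite invr_gt0 invf_lt1// => /(_ q0 q1 (powR_ge0 _ _) (powR_ge0 _ _)).
rewrite powRK ?gt_eqF// -[(y `^ q) `^ _]powRrM.
have -> : q * (1 - q^-1) = q - 1 by rewrite mulrBr mulr1 divff ?gt_eqF.
set X := x `^ q; set Y := y `^ q; set Z := x * _; set c := q^-1 => h.
by rewrite !mulrBl mulrBr mul1r mul1r; lra.
Qed.

(** If [y <= 2 * c * x] the first term on the right suffices, otherwise the second. The factor 1/2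
    is there so that [wmax_bound] can absorb the [y] term. *)
Lemma young_crude (R : realType) (q c x y : R) : 1 < q -> 1 <= c -> 0 <= x -> 0 <= y ->
  c * (x * y `^ (q - 1)) <= (2 * c) `^ q * x `^ q + y `^ q / 2.
Proof.
move=> q1 c1 x0 y0; have q0 : 0 < q by exact: lt_trans q1.
have c0 : 0 <= c by exact: le_trans c1.
have cx0 : 0 <= 2 * c * x by rewrite !mulr_ge0.
have [yx|xy] := leP y (2 * c * x).
  apply: (@le_trans _ _ ((2 * c * x) `^ q)); last first.
    by rewrite powRM ?mulr_ge0// lerDl divr_ge0// powR_ge0.
  rewrite -(mulr_powRB1 cx0 q0) mulrA; apply: ler_pM; rewrite ?mulr_ge0 ?powR_ge0//.
    by rewrite -mulrA ler_peMl ?mulr_ge0// ler1n.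
  by apply: le_powR_base => //; rewrite subr_ge0 ltW.
apply: (@le_trans _ _ (y `^ q / 2)); last first.
  by rewrite lerDr mulr_ge0 ?powR_ge0.
rewrite -(mulr_powRB1 y0 q0) mulrA [y * _ / 2]mulrAC ler_wpM2r ?powR_ge0//.
by rewrite ler_pdivlMr// mulrC mulrA ltW.
Qed.

(** * Doob's inequality for the maximal function of a measure *)

(* Truncation to [k <= n <= N] of the maximal function of the averages over
   [1, n] with respect to the measure [u]; its value is 0 for [k > N]. *)
Definition wmax (R : realType) (u F : nat -> R) (N k : nat) : R :=
  \big[Num.max/0]_(k <= n < N.+1)
    ((\sum_(1 <= j < n.+1) u j)^-1 * \sum_(1 <= j < n.+1) u j * F j).

Lemma wmax_ge0 (R : realType) (u F : nat -> R) (N k : nat) : 0 <= wmax u F N k.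
Proof. exact: bigmax_ge_id. Qed.

Lemma le_wmax (R : realType) (u F : nat -> R) (N k n : nat) : (k <= n <= N)%N ->
  (\sum_(1 <= j < n.+1) u j)^-1 * \sum_(1 <= j < n.+1) u j * F j <= wmax u F N k.
Proof.
move=> kn; rewrite /wmax; apply: (@bigmax_sup_seq _ _ _ _ _ n) => //.
by rewrite mem_index_iota ltnS.
Qed.

Lemma sum1S (R : realType) (a : nat -> R) (n : nat) :
  \sum_(1 <= k < n.+2) a k = \sum_(1 <= k < n.+1) a k + a n.+1.
Proof. by rewrite big_nat_recr. Qed.

Lemma sum1_ge0 (R : realType) (a : nat -> R) (n : nat) :
  (forall k, (1 <= k)%N -> 0 <= a k) -> 0 <= \sum_(1 <= k < n) a k.
Proof. by move=> a0; rewrite big_nat sumr_ge0// => k /andP[/a0]. Qed.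

Lemma sum1_gt0 (R : realType) (a : nat -> R) (n : nat) : (1 <= n)%N ->
  (forall k, (1 <= k)%N -> 0 < a k) -> 0 < \sum_(1 <= k < n.+1) a k.
Proof.
case: n => // n _ a0; rewrite sum1S ltr_wpDl ?a0// sum1_ge0// => k /a0.
exact: ltW.
Qed.

Lemma ler_sum1 (R : realType) (a b : nat -> R) (n : nat) :
  (forall k, (1 <= k)%N -> a k <= b k) ->
  \sum_(1 <= k < n) a k <= \sum_(1 <= k < n) b k.
Proof.
by move=> ab; rewrite !(big_nat _ _ 1 n) ler_sum// => k /andP[/ab].
Qed.

Lemma eq_sum1 (R : realType) (a b : nat -> R) (n : nat) :
  (forall k, (1 <= k)%N -> a k = b k) ->
  \sum_(1 <= k < n) a k = \sum_(1 <= k < n) b k.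
Proof.
by move=> ab; rewrite !(big_nat _ _ 1 n); apply: eq_bigr => k /andP[/ab].
Qed.

(* Deterministic form of Doob's inequality: [wmax] only changes value at
   those [n] where it equals the n-th average, so summation by parts turns
   [\sum u F M^(q-1)] into [\sum U M (M^(q-1) - M_(n+1)^(q-1))]. *)
Lemma doob_sum (R : realType) (u F : nat -> R) (q : R) (N : nat) : 1 < q ->
  (forall k, (1 <= k)%N -> 0 < u k) -> (forall k, (1 <= k)%N -> 0 <= F k) ->
  (1 - q^-1) * \sum_(1 <= k < N.+1) u k * wmax u F N k `^ q <=
    \sum_(1 <= k < N.+1) u k * F k * wmax u F N k `^ (q - 1).
Proof.
move=> q1 u0 F0; have q0 : 0 < q by exact: lt_trans q1.
set M := wmax u F N.
pose U n := \sum_(1 <= k < n.+1) u k.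
pose S n := \sum_(1 <= k < n.+1) u k * F k.
have MN : M N.+1 = 0 by rewrite /M /wmax big_geq.
(* The inequality summed up to [n], with its boundary terms, suits induction; at [n = N] these terms
   vanish because [M N.+1] is an empty maximum. *)
suff H n : (n <= N)%N ->
    (1 - q^-1) * (\sum_(1 <= k < n.+1) u k * M k `^ q - U n * M n.+1 `^ q) <=
    \sum_(1 <= k < n.+1) u k * F k * M k `^ (q - 1) - S n * M n.+1 `^ (q - 1).
  have := H N (leqnn _); rewrite MN !powR0 ?gt_eqF ?subr_gt0//.
  by rewrite !mulr0 !subr0.
elim: n => [_|n IH nN].
  by rewrite /U /S !big_geq// !mul0r !subrr mulr0.
have {}IH := IH (ltnW nN).
rewrite /U /S !sum1S -/(U n) -/(S n).
have Un : 0 < U n.+1 by apply: sum1_gt0.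
have key : U n.+1 * ((1 - q^-1) * (M n.+1 `^ q - M n.+2 `^ q)) <=
    S n.+1 * (M n.+1 `^ (q - 1) - M n.+2 `^ (q - 1)).
  have Mrec : M n.+1 = Num.max ((U n.+1)^-1 * S n.+1) (M n.+2).
    by rewrite /M /wmax big_ltn.
  have [Ml|Mr] := leP (M n.+2) ((U n.+1)^-1 * S n.+1); last first.
    by rewrite Mrec (max_idPr (ltW Mr)) !subrr !mulr0.
  have ME : M n.+1 = (U n.+1)^-1 * S n.+1 by rewrite Mrec (max_idPl Ml).
  have SE : S n.+1 = U n.+1 * M n.+1 by rewrite ME mulVKf ?gt_eqF.
  rewrite SE -(mulrA (U n.+1)) ler_pM2l//.
  by apply: powR_diff_le => //; apply: wmax_ge0.
move: key; rewrite /U /S !sum1S -/(U n) -/(S n).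
move: IH; set a := M n.+1 `^ q; set b := M n.+2 `^ q.
set c := M n.+1 `^ (q - 1); set d := M n.+2 `^ (q - 1).
set X := \sum_(_ <= _ < _) _; set Y := \sum_(_ <= _ < _) _.
set e := 1 - q^-1; set v := u n.+1; set G := F n.+1.
move=> h1 h2; rewrite -subr_ge0.
move: h1 h2; rewrite -subr_ge0 -(subr_ge0 (_ * (e * _))) => h1 h2.
apply: le_trans (addr_ge0 h1 h2) _; rewrite le_eqVlt; apply/orP; left.
by apply/eqP; ring.
Qed.

(** Not sharp: [2 / (1 - q^-1)] comes from [young_crude] with [c = (1 - q^-1)^-1], the outer 2 from
    absorbing half of the left side. *)
Definition wmax_const (R : realType) (q : R) : R := 2 * (2 / (1 - q^-1)) `^ q.

(** Young's inequality applied to the right side of [doob_sum] produces half of the left side again;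
    all sums are finite, so it can be subtracted. The constant depends neither on [u] nor on [N]. *)
Lemma wmax_bound (R : realType) (u F : nat -> R) (q : R) (N : nat) : 1 < q ->
  (forall k, (1 <= k)%N -> 0 < u k) -> (forall k, (1 <= k)%N -> 0 <= F k) ->
  \sum_(1 <= k < N.+1) u k * wmax u F N k `^ q <=
    wmax_const q * \sum_(1 <= k < N.+1) u k * F k `^ q.
Proof.
move=> q1 u0 F0; have q0 : 0 < q by exact: lt_trans q1.
have := doob_sum N q1 u0 F0.
set M := wmax u F N; set c := 1 - q^-1.
have c0 : 0 < c by rewrite subr_gt0 invf_lt1.
have c1 : 1 <= c^-1 by rewrite invf_ge1// gerBl invr_ge0 ltW.
rewrite -ler_pdivlMl// => h.
have {h} : \sum_(1 <= k < N.+1) u k * M k `^ q <=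
    (2 * c^-1) `^ q * (\sum_(1 <= k < N.+1) u k * F k `^ q) +
    (\sum_(1 <= k < N.+1) u k * M k `^ q) / 2.
  apply: (le_trans h); rewrite mulr_sumr mulr_sumr mulr_suml -big_split/=.
  apply: ler_sum1 => k k1.
  have := young_crude q1 c1 (F0 k k1) (wmax_ge0 u F N k).
  by rewrite -(ler_pM2l (u0 k k1)) -/M; congr (_ <= _); ring.
rewrite /wmax_const -/c; set X := \sum_(_ <= _ < _) _; set Y := \sum_(_ <= _ < _) _.
set K := _ `^ q => h; rewrite -mulrA; lra.
Qed.

(** * Muckenhoupt's theorem for truncated maximal functions *)

Lemma powR_mulD (R : realType) (x a b : R) : 0 < x -> x `^ a * x `^ b = x `^ (a + b).
Proof. by move=> x0; rewrite powRD// (gt_eqF x0) implybT. Qed.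

Lemma avg_ge0 (R : realType) (a : nat -> R) (n : nat) :
  (forall k, (1 <= k)%N -> 0 <= a k) -> 0 <= avg a n.
Proof. by move=> a0; rewrite mulr_ge0 ?invr_ge0// sum1_ge0. Qed.

Lemma avg_gt0 (R : realType) (a : nat -> R) (n : nat) : (1 <= n)%N ->
  (forall k, (1 <= k)%N -> 0 < a k) -> 0 < avg a n.
Proof. by move=> n1 a0; rewrite mulr_gt0 ?invr_gt0 ?ltr0n// sum1_gt0. Qed.

Lemma wmax1E (R : realType) (f : nat -> R) (N k : nat) :
  wmax (fun=> 1) f N k = \big[Num.max/0]_(k <= n < N.+1) avg f n.
Proof.
apply: eq_bigr => n _; rewrite /avg sumr_const_nat subn1; congr (_ * _).
by apply: eq_bigr => j _; rewrite mul1r.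
Qed.

Definition dual_weight (R : realType) (p : R) (w : nat -> R) (k : nat) : R :=
  w k `^ (- (p - 1)^-1).

(* Lerner's proof of Muckenhoupt's theorem: with [s = w^(-1/(p-1))] and [M_u]
   the maximal function of the measure [u], one has pointwise
   [(M f)^(p-1) <= B M_w ((M_s (f / s))^(p-1) / w)], and both [M_w] and [M_s]
   are bounded by Doob's inequality. *)
Lemma avgmax_pointwise (R : realType) (w f : nat -> R) (p B : R) (N k : nat) :
  1 < p -> weight w -> (forall k, (1 <= k)%N -> 0 <= f k) ->
  (forall n, (1 <= n)%N ->
     avg w n * (avg (dual_weight p w) n) `^ (p - 1) <= B) ->
  (1 <= k)%N ->
  wmax (fun=> 1) f N k `^ (p - 1) <= B * wmax w (fun j =>
    wmax (dual_weight p w) (fun i => f i / dual_weight p w i) N j `^ (p - 1) / w j) N k.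
Proof.
move=> p1 w0 f0 HB k1; set s := dual_weight p w.
set G := wmax s _ N; have p10 : 0 < p - 1 by rewrite subr_gt0.
set H := wmax w _ N k.
have s0 j : (1 <= j)%N -> 0 < s j by move=> /w0 wj; apply: powR_gt0.
have B0 : 0 <= B.
  apply: le_trans (HB 1%N isT); rewrite mulr_ge0 ?powR_ge0//.
  by apply: avg_ge0 => j /w0/ltW.
have BH0 : 0 <= B * H by rewrite mulr_ge0// wmax_ge0.
suff h : wmax (fun=> 1) f N k <= (B * H) `^ (p - 1)^-1.
  rewrite -[leRHS](@powRVK _ (p - 1)) ?gt_eqF//.
  by apply: le_powR_base => //; [exact: ltW|exact: wmax_ge0].
rewrite wmax1E big_nat; apply: bigmax_le => [|n /andP[kn]]; first exact: powR_ge0.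
rewrite ltnS => nN.
have n1 : (1 <= n)%N by exact: leq_trans kn.
have a0 : 0 <= avg f n by exact: avg_ge0.
rewrite -[leLHS](@powRK _ (p - 1)) ?gt_eqF//.
apply: le_powR_base; rewrite ?invr_ge0 ?powR_ge0 ?(ltW p10)//.
set W := \sum_(1 <= j < n.+1) w j; set S := \sum_(1 <= j < n.+1) s j.
set F := \sum_(1 <= j < n.+1) f j.
have W0 : 0 < W by exact: sum1_gt0.
have S0 : 0 < S by exact: sum1_gt0.
have F0 : 0 <= F by exact: sum1_ge0.
have n0 : 0 < n%:R :> R by rewrite ltr0n.
(* The average of [f / s] over [1, n] for the measure [s] is [F / S], and it competes in the maximum
   at every [j <= n]. *)
have GF j : (1 <= j <= n)%N -> S^-1 * F <= G j.
  move=> /andP[j1 jn].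
  have -> : F = \sum_(1 <= i < n.+1) s i * (f i / s i).
    by apply: eq_sum1 => i i1; rewrite mulrC divfK// gt_eqF// s0.
  by apply: le_wmax; rewrite jn.
(* The density [w] of the measure cancels the division by [w], so the lower bound from [GF],
   constant in [j], is merely counted [n] times. *)
have HG : W^-1 * (n%:R * (S^-1 * F) `^ (p - 1)) <= H.
  apply: (@le_trans _ _ (W^-1 * \sum_(1 <= j < n.+1) w j * (G j `^ (p - 1) / w j))).
    rewrite ler_pM2l ?invr_gt0//.
    have -> : n%:R * (S^-1 * F) `^ (p - 1) =
        \sum_(1 <= j < n.+1) (S^-1 * F) `^ (p - 1).
      by rewrite sumr_const_nat subn1/= mulr_natl.
    rewrite !(big_nat _ _ 1) ler_sum// => j /andP[j1 jn].
    rewrite [w j * _]mulrC divfK ?gt_eqF ?w0//; apply: le_powR_base; first exact: ltW.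
      by rewrite mulr_ge0// invr_ge0 ltW.
    by rewrite GF// j1.
  by apply: le_wmax; rewrite kn.
apply: le_trans (ler_pM _ _ (HB n n1) HG); last 2 first.
- by rewrite mulr_ge0 ?powR_ge0// avg_ge0// => j /w0/ltW.
- by rewrite !mulr_ge0 ?invr_ge0 ?powR_ge0 ?ltW.
(* The product on the right is [(W / n) (S / n)^(p-1)] times [(n / W) (F / S)^(p-1)], that is
   [(F / n)^(p-1)]. *)
rewrite /avg -/W -/S -/F.
have -> : n%:R^-1 * F = (n%:R^-1 * S) * (S^-1 * F).
  by rewrite mulrA mulfK ?gt_eqF.
rewrite (@powRM _ (n%:R^-1 * S)); first last.
- by rewrite mulr_ge0// invr_ge0 ltW.
- by rewrite mulr_ge0 ?invr_ge0// ltW.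
rewrite le_eqVlt; apply/orP; left; apply/eqP.
set X := _ `^ _; set Y := _ `^ _.
by field; rewrite !gt_eqF.
Qed.

(** With [q = p / (p - 1)] the conjugate exponent, the factors are [B^q], from raising the pointwise
    bound to the power [q], and the Doob constants on l^q(w) and on l^p of the dual weight. *)
Definition muckenhoupt_const (R : realType) (p B : R) : R :=
  B `^ (p / (p - 1)) * (wmax_const (p / (p - 1)) * wmax_const p).

(** The pointwise bound is raised to the conjugate power [q], then Doob's inequality is used for the
    measure [w] with exponent [q] and for the dual weight [s] with exponent [p]. The weights fit
    together because [w^(1-q) = s] and [s^(1-p) = w]. *)
Lemma avgmax_bound (R : realType) (w f : nat -> R) (p B : R) (N : nat) :
  1 < p -> weight w -> (forall k, (1 <= k)%N -> 0 <= f k) ->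
  (forall n, (1 <= n)%N ->
     avg w n * (avg (dual_weight p w) n) `^ (p - 1) <= B) ->
  \sum_(1 <= k < N.+1) w k * wmax (fun=> 1) f N k `^ p <=
    muckenhoupt_const p B * \sum_(1 <= k < N.+1) w k * f k `^ p.
Proof.
move=> p1 w0 f0 HB; have p10 : 0 < p - 1 by rewrite subr_gt0.
have p0 : 0 < p by exact: lt_trans p1.
have pneq : p - 1 != 0 by rewrite gt_eqF.
pose q := p / (p - 1).
have q0 : 0 < q by rewrite divr_gt0.
have q1 : 1 < q by rewrite ltr_pdivlMr// mul1r gtrBl.
have pw := fun k => @avgmax_pointwise R w f p B N k p1 w0 f0 HB.
move: pw => /=; set s := dual_weight p w.
set G := wmax s _ N; set H := wmax w _ N => pw.
have s0 j : (1 <= j)%N -> 0 < s j by move=> /w0 wj; apply: powR_gt0.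
have B0 : 0 <= B.
  apply: le_trans (HB 1%N isT); rewrite mulr_ge0 ?powR_ge0//.
  by apply: avg_ge0 => j /w0/ltW.
have C0 r : 0 <= @wmax_const R r by rewrite mulr_ge0// powR_ge0.
rewrite /muckenhoupt_const -/q.
apply: (@le_trans _ _ (B `^ q * \sum_(1 <= k < N.+1) w k * H k `^ q)).
  rewrite mulr_sumr; apply: ler_sum1 => k k1; rewrite mulrCA.
  rewrite ler_pM2l ?w0// -powRM ?wmax_ge0//.
  have -> : p = (p - 1) * q by rewrite /q mulrC divfK.
  rewrite powRrM; apply: le_powR_base; rewrite ?powR_ge0 ?(ltW q0)//.
  exact: pw.
rewrite -mulrA ler_wpM2l ?powR_ge0// -mulrA.
apply: le_trans (wmax_bound N q1 w0 _) _ => [k k1|].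
  by rewrite divr_ge0 ?powR_ge0// ltW// w0.
rewrite ler_wpM2l//.
rewrite (_ : \sum_(_ <= _ < _) _ = \sum_(1 <= k < N.+1) s k * G k `^ p).
  apply: le_trans (wmax_bound N p1 s0 _) _ => [k k1|].
    by rewrite divr_ge0 ?f0// ltW// s0.
  rewrite ler_wpM2l// le_eqVlt; apply/orP; left; apply/eqP.
  apply: eq_sum1 => k k1.
  rewrite powRM ?f0 ?invr_ge0 ?(ltW (s0 _ _))// mulrCA [RHS]mulrC; congr (_ * _).
  rewrite -powR_inv1 ?(ltW (s0 _ _))// -powRrM -{1}(@powRr1 _ (s k)) ?(ltW (s0 _ _))//.
  rewrite powR_mulD ?s0// -powRrM -[RHS]powRr1 ?(ltW (w0 _ _))//.
  by congr (_ `^ _); field.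
apply: eq_sum1 => k k1.
have wk := w0 k k1.
rewrite powRM ?invr_ge0 ?powR_ge0 ?(ltW wk)// mulrCA mulrC -powRrM.
congr (_ * _); last by rewrite /q mulrC divfK.
rewrite -powR_inv1 ?(ltW wk)// -powRrM -{1}(@powRr1 _ (w k)) ?(ltW wk)//.
by rewrite powR_mulD// /s /dual_weight; congr (_ `^ _); rewrite /q; field.
Qed.

(** * Norms and A_q constants as inequalities between reals *)

(** For [0 <= c] this is equivalent to [lpnorm q v f <= c%:E] (see [lpnorm_leP]), but it avoids
    extended reals and passes to pointwise limits. *)
Definition lp_le (R : realType) (q : R) (v f : nat -> R) (c : R) : Prop :=
  forall n, \sum_(1 <= k < n) v k * `|f k| `^ q <= c `^ q.

Lemma nneseries1_leP (R : realType) (u : nat -> \bar R) (c : \bar R) :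
  (forall k, (1 <= k)%N -> (0 <= u k)%E) ->
  (\sum_(1 <= k <oo) u k <= c)%E <->
  (forall n, (\sum_(1 <= k < n) u k <= c)%E).
Proof.
move=> u0; split=> [h n|h].
  by apply: le_trans h; apply: nneseries_lim_ge => k k1 _; exact: u0.
apply: lime_le; last exact: nearW.
by apply: is_cvg_nneseries => k k1 _; exact: u0.
Qed.

Lemma poweR_inv_le (R : realType) (q c : R) (x : \bar R) : 0 < q -> 0 <= c ->
  (0 <= x)%E -> (poweR x q^-1 <= c%:E)%E <-> (x <= (c `^ q)%:E)%E.
Proof.
move=> q0 c0; case: x => [x| |]//; last first.
  by move=> _; rewrite poweRyr ?invr_neq0 ?gt_eqF//; split.
rewrite lee_fin => x0; rewrite poweR_EFin !lee_fin; split => h.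
  by rewrite -(@powRVK _ q x) ?gt_eqF//; apply: le_powR_base; rewrite ?powR_ge0 ?(ltW q0).
rewrite -(@powRK _ q c) ?gt_eqF//.
by apply: le_powR_base; rewrite ?invr_ge0 ?powR_ge0 ?(ltW q0).
Qed.

Lemma lpnormE_leP (R : realType) (q : R) (v : nat -> R) (F : nat -> \bar R) (c : R) :
  0 < q -> weight v -> 0 <= c ->
  (lpnormE q v F <= c%:E)%E <->
  (forall n, (\sum_(1 <= k < n) (v k)%:E * poweR `|F k| q <= (c `^ q)%:E)%E).
Proof.
move=> q0 v0 c0; have u0 k : (1 <= k)%N -> (0 <= (v k)%:E * poweR `|F k| q)%E.
  by move=> /v0/ltW vk; rewrite mule_ge0 ?lee_fin// poweR_ge0.
rewrite /lpnormE; split => [h|h].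
  apply/(nneseries1_leP _ u0)/poweR_inv_le => //.
  by apply: nneseries_ge0 => k k1 _; exact: u0.
apply/poweR_inv_le => //; last exact/(nneseries1_leP _ u0).
by apply: nneseries_ge0 => k k1 _; exact: u0.
Qed.

Lemma lpnormE_fin_leP (R : realType) (q : R) (v : nat -> R) (F : nat -> \bar R) (c : R) :
  0 < q -> weight v -> 0 <= c ->
  (forall k, (1 <= k)%N -> F k \is a fin_num) ->
  (lpnormE q v F <= c%:E)%E <-> lp_le q v (fun k => fine (F k)) c.
Proof.
move=> q0 v0 c0 Ff.
have E n : (\sum_(1 <= k < n) (v k)%:E * poweR `|F k| q =
    (\sum_(1 <= k < n) v k * `|fine (F k)| `^ q)%R%:E)%E.
  rewrite -sumEFin !(big_nat _ _ 1); apply: eq_bigr => k /andP[k1 _].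
  by rewrite -{1}(fineK (Ff k k1)) abse_EFin poweR_EFin EFinM.
split=> [/lpnormE_leP h n|h]; first by rewrite -lee_fin -E; exact: h.
by apply/lpnormE_leP => // n; rewrite E lee_fin.
Qed.

Lemma lpnorm_leP (R : realType) (q : R) (v f : nat -> R) (c : R) :
  0 < q -> weight v -> 0 <= c -> (lpnorm q v f <= c%:E)%E <-> lp_le q v f c.
Proof. by move=> q0 v0 c0; apply: lpnormE_fin_leP. Qed.

Lemma lp_le_term (R : realType) (q : R) (v f : nat -> R) (c : R) (k : nat) :
  weight v -> lp_le q v f c -> (1 <= k)%N -> v k * `|f k| `^ q <= c `^ q.
Proof.
move=> v0 h k1; apply: le_trans (h k.+1); case: k k1 => // k _.
by rewrite sum1S lerDr sum1_ge0// => j /v0/ltW vj; rewrite mulr_ge0// powR_ge0.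
Qed.

Lemma avg_le_maxop (R : realType) (f : nat -> R) (k n : nat) : (1 <= n)%N -> (k <= n)%N ->
  ((avg (fun j => `|f j|) n)%:E <= maxop f k)%E.
Proof. by move=> n1 kn; apply: ereal_sup_ubound; exists n => //=; rewrite n1. Qed.

Lemma maxop_ge0 (R : realType) (f : nat -> R) (k : nat) : (0 <= maxop f k)%E.
Proof.
by apply: le_trans (@avg_le_maxop R f k k.+1 isT (leqnSn k)); rewrite lee_fin avg_ge0.
Qed.

Lemma maxop_le_avg_le (R : realType) (f : nat -> R) (k n : nat) (c : R) : (1 <= k)%N ->
  (maxop f k <= c%:E)%E -> (k <= n)%N -> avg (fun j => `|f j|) n <= c.
Proof.
move=> k1 h kn; rewrite -lee_fin; apply: le_trans h.
by apply: avg_le_maxop => //; exact: leq_trans kn.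
Qed.

Lemma Ap_const_ge (R : realType) (q : R) (w : nat -> R) (n : nat) : inAp q w ->
  (1 <= n)%N -> avg w n * (avg (dual_weight q w) n) `^ (q - 1) <= Apc q w.
Proof.
move=> [w0 wfin] n1.
have h : ((avg w n * (avg (dual_weight q w) n) `^ (q - 1))%:E <= Ap_const q w)%E.
  by apply: ereal_sup_ubound; exists n.
by move: wfin h; rewrite /Apc; case: (Ap_const q w) => [r||]//= _; rewrite lee_fin.
Qed.

(** Membership is proved along with the bound: [fine] sends [+oo] to 0, so a bound on [Apc] alone
    would not give finiteness. *)
Lemma Ap_const_le (R : realType) (q c : R) (w : nat -> R) : weight w ->
  (forall n, (1 <= n)%N -> avg w n * (avg (dual_weight q w) n) `^ (q - 1) <= c) ->
  inAp q w /\ Apc q w <= c.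
Proof.
move=> w0 h.
have hE : (Ap_const q w <= c%:E)%E.
  by apply: ge_ereal_sup => _ [n n1 <-]; rewrite lee_fin; exact: h.
have wA : inAp q w by split => //; apply: le_lt_trans hE (ltry _).
split=> //; move: hE; rewrite /Apc.
have : (0 <= Ap_const q w)%E.
  apply: le_trans (ereal_sup_ubound _); last by exists 1%N.
  by rewrite lee_fin mulr_ge0 ?powR_ge0// avg_ge0// => k /w0/ltW.
by case: (Ap_const q w).
Qed.

(** The average over the single index 1 contributes exactly 1 to the supremum. This puts the
    constant in the range where [phi] is positive and increasing. *)
Lemma Apc_ge1 (R : realType) (q : R) (w : nat -> R) : 1 < q -> inAp q w -> 1 <= Apc q w.
Proof.
move=> q1 wA; apply: le_trans (Ap_const_ge wA (leqnn 1)).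
have w1 : 0 < w 1%N by case: wA => + _; exact.
rewrite /avg !big_nat1 invr1 !mul1r /dual_weight -powRrM mulNr mulVf ?powR_inv1//.
- by rewrite divff ?gt_eqF.
- exact: ltW.
- by rewrite gt_eqF// subr_gt0.
Qed.

(** * The norm of the maximal operator on l^p(w) is finite and positive *)

Lemma lp_le_wmax (R : realType) (w h : nat -> R) (p B t : R) (n N : nat) :
  1 < p -> weight w ->
  (forall n, (1 <= n)%N -> avg w n * (avg (dual_weight p w) n) `^ (p - 1) <= B) ->
  lp_le p w h t ->
  (n <= N.+1)%N ->
  \sum_(1 <= k < n) w k * wmax (fun=> 1) (fun j => `|h j|) N k `^ p <=
    muckenhoupt_const p B * t `^ p.
Proof.
move=> p1 w0 HB ht nN.
have C0 : 0 <= muckenhoupt_const p B.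
  by rewrite !mulr_ge0 ?powR_ge0.
apply: le_trans (ler_wpM2l C0 (ht N.+1)).
apply: le_trans (avgmax_bound N p1 w0 (fun k _ => normr_ge0 (h k)) HB).
have [n1|] := leqP 1 n; last first.
  rewrite ltnS leqn0 => /eqP ->; rewrite big_geq// sum1_ge0// => k /w0/ltW wk.
  by rewrite mulr_ge0// powR_ge0.
rewrite [leRHS](@big_cat_nat _ _ _ n)//= lerDl big_nat sumr_ge0// => k /andP[nk _].
by rewrite mulr_ge0 ?powR_ge0// ltW// w0// (leq_trans n1).
Qed.

(** A single term of the bound on [wmax] controls all averages over [1, n] with [n >= k], uniformly
    in [n]. This makes [fine (maxop h k)] meaningful. *)
Lemma maxop_fin_num (R : realType) (w h : nat -> R) (p t : R) (k : nat) :
  1 < p -> inAp p w -> lp_le p w h t -> (1 <= k)%N -> maxop h k \is a fin_num.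
Proof.
move=> p1 wA ht k1; have w0 := wA.1; have wk := w0 k k1.
have p0 : 0 < p by exact: lt_trans p1.
rewrite ge0_fin_numE ?maxop_ge0//.
pose c := (muckenhoupt_const p (Apc p w) * t `^ p / w k) `^ p^-1.
apply: (@le_lt_trans _ _ c%:E); last exact: ltry.
apply: ge_ereal_sup => _ [n /= /andP[n1 kn] <-]; rewrite lee_fin.
apply: (@le_trans _ _ (wmax (fun=> 1) (fun j => `|h j|) n k)).
  rewrite wmax1E; apply: (@bigmax_sup_seq _ _ _ _ _ n) => //.
  by rewrite mem_index_iota kn leqnn.
have HB := fun n => @Ap_const_ge R p w n wA.
rewrite -[leLHS](@powRK _ p) ?gt_eqF ?wmax_ge0//.
apply: le_powR_base; rewrite ?invr_ge0 ?powR_ge0 ?(ltW p0)//.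
rewrite ler_pdivlMr// mulrC.
apply: le_trans (lp_le_wmax p1 w0 HB ht (_ : k.+1 <= n.+1)%N) => //.
case: k k1 wk kn {c} => // k _ wk kn.
by rewrite sum1S lerDr sum1_ge0// => j /w0/ltW wj; rewrite mulr_ge0// powR_ge0.
Qed.

(** Only finitely many [k] enter a partial sum; for each, some average reaches half of the supremum,
    and one truncation sees all these averages. The factor [2 ^ p] pays for the halves. *)
Lemma lp_le_maxop (R : realType) (w h : nat -> R) (p t : R) :
  1 < p -> inAp p w -> lp_le p w h t -> 0 <= t ->
  lp_le p w (fun k => fine (maxop h k))
    ((2 `^ p * muckenhoupt_const p (Apc p w)) `^ p^-1 * t).
Proof.
move=> p1 wA ht t0 K; have w0 := wA.1.
have p0 : 0 < p by exact: lt_trans p1.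
have C0 : 0 <= muckenhoupt_const p (Apc p w) by rewrite !mulr_ge0 ?powR_ge0.
have HB := fun n => @Ap_const_ge R p w n wA.
have /choice[nk Hnk] : forall k, exists n, (1 <= k)%N ->
    (k <= n)%N /\ fine (maxop h k) <= 2 * avg (fun j => `|h j|) n.
  move=> k; have [k1|] := leqP 1 k; last by exists 0%N.
  have mfin := maxop_fin_num p1 wA ht k1.
  have [m0|m0] := leP (fine (maxop h k)) 0.
    by exists k; split=> //; apply: le_trans m0 _; rewrite mulr_ge0// avg_ge0.
  have : ((fine (maxop h k) / 2)%:E < maxop h k)%E.
    by rewrite -[ltRHS]fineK// lte_fin ltr_pdivrMr// ltr_pMr// ltr1n.
  move=> /ereal_sup_gt[_ [n /= /andP[n1 kn] <-]]; rewrite lte_fin => hn.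
  by exists n; split=> //; rewrite -ler_pdivrMl// mulrC ltW.
(* Large enough for every chosen [nk k] with [k < K], and for the condition [K <= N.+1] of
   [lp_le_wmax]. *)
pose N := (\max_(1 <= k < K) nk k + K)%N.
rewrite powRM ?powR_ge0// powRVK ?gt_eqF ?mulr_ge0 ?powR_ge0// -mulrA.
apply: le_trans (ler_wpM2l (powR_ge0 _ _) (lp_le_wmax p1 w0 HB ht (_ : K <= N.+1)%N)).
  rewrite mulr_sumr !(big_nat _ _ 1) ler_sum// => k /andP[k1 kK].
  have [knk Hk] := Hnk k k1.
  rewrite mulrCA ler_pM2l ?w0// -powRM ?wmax_ge0//.
  rewrite ger0_norm ?fine_ge0 ?maxop_ge0//.
  apply: le_powR_base; rewrite ?(ltW p0) ?fine_ge0 ?maxop_ge0//.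
  apply: le_trans Hk _; rewrite ler_pM2l// wmax1E.
  apply: (@bigmax_sup_seq _ _ _ _ _ (nk k)) => //.
  rewrite mem_index_iota knk ltnS/=; apply: leq_trans (leq_addr _ _).
  by apply: (@leq_bigmax_seq _ _ _ _ k) => //; rewrite mem_index_iota k1.
by rewrite /N; apply: leqW; apply: leq_addl.
Qed.

Lemma opnormM_ge0 (R : realType) (w : nat -> R) (p : R) :
  0 < p -> weight w -> (0 <= opnormM p w)%E.
Proof.
move=> p0 w0; apply: le_trans (ereal_sup_ubound _); last first.
  exists (fun=> 0) => //=; apply/lpnorm_leP => // n.
  by rewrite big1 ?powR_ge0// => k _; rewrite normr0 powR0 ?gt_eqF// mulr0.
exact: poweR_ge0.
Qed.

(** This is Muckenhoupt's theorem; it makes [fine (opnormM p w)] the true norm and not the default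
    value 0. *)
Lemma opnormM_fin_num (R : realType) (w : nat -> R) (p : R) :
  1 < p -> inAp p w -> opnormM p w \is a fin_num.
Proof.
move=> p1 wA; have p0 : 0 < p by exact: lt_trans p1.
rewrite ge0_fin_numE ?opnormM_ge0//; last exact: wA.1.
apply: (@le_lt_trans _ _
  ((2 `^ p * muckenhoupt_const p (Apc p w)) `^ p^-1 * 1)%:E); last exact: ltry.
apply: ge_ereal_sup => _ [f /= /(lpnorm_leP _ p0 wA.1 ler01) f1 <-].
apply/lpnormE_fin_leP => //; first exact: wA.1.
- by rewrite mulr_ge0 ?powR_ge0.
- by move=> k k1; apply: maxop_fin_num f1 k1.
- exact: lp_le_maxop.
Qed.

Lemma avg_mulr (R : realType) (c : R) (a : nat -> R) (n : nat) :
  avg (fun k => c * a k) n = c * avg a n.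
Proof. by rewrite /avg -mulr_sumr mulrCA. Qed.

Lemma lp_leZ (R : realType) (w f : nat -> R) (p c t : R) : 0 <= c -> 0 <= t ->
  lp_le p w f t -> lp_le p w (fun k => c * f k) (c * t).
Proof.
move=> c0 t0 ft n; rewrite powRM//.
apply: le_trans (ler_wpM2l (powR_ge0 _ _) (ft n)); rewrite mulr_sumr.
by apply: ler_sum => k _; rewrite normrM (ger0_norm c0) powRM// mulrCA.
Qed.

(** The supremum in [opnormM] runs over the unit ball, so [h] is divided by [t], and homogeneity of
    the averages carries the bound back. *)
Lemma lp_le_opnorm (R : realType) (w h : nat -> R) (p t : R) :
  1 < p -> inAp p w -> 0 < t -> lp_le p w h t ->
  lp_le p w (fun k => fine (maxop h k)) (fine (opnormM p w) * t).
Proof.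
move=> p1 wA t0 ht; have p0 : 0 < p by exact: lt_trans p1.
set N := fine _; have NE : opnormM p w = N%:E by rewrite fineK// opnormM_fin_num.
pose f k := t^-1 * h k.
have f1 : lp_le p w f 1.
  rewrite -(mulVf (lt0r_neq0 t0)).
  by apply: lp_leZ ht; rewrite ?invr_ge0 ltW.
have N0 : 0 <= N by rewrite fine_ge0// opnormM_ge0//; exact: wA.1.
have fN : lp_le p w (fun k => fine (maxop f k)) N.
  apply/lpnormE_fin_leP => //; first exact: wA.1.
    by move=> k k1; apply: maxop_fin_num f1 k1.
  rewrite -NE; apply: ereal_sup_ubound; exists f => //=.
  by apply/lpnorm_leP => //; exact: wA.1.
rewrite mulrC => n; apply: le_trans (lp_leZ (ltW t0) N0 fN n).
apply: ler_sum1 => k k1; rewrite ler_pM2l ?wA.1//.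
apply: le_powR_base; rewrite ?(ltW p0)//.
have m0 g : 0 <= fine (maxop g k) by rewrite fine_ge0 ?maxop_ge0.
rewrite !ger0_norm ?mulr_ge0 ?m0 ?(ltW t0)// -lee_fin.
rewrite fineK ?(maxop_fin_num p1 wA ht)//.
apply: ge_ereal_sup => _ [j /= /andP[j1 kj] <-]; rewrite lee_fin.
have -> : avg (fun i => `|h i|) j = t * avg (fun i => `|f i|) j.
  rewrite -avg_mulr /avg; congr (_ * _); apply: eq_bigr => i _.
  by rewrite /f normrM gtr0_norm ?invr_gt0// mulVKf ?gt_eqF.
rewrite ler_pM2l//; apply: (@maxop_le_avg_le _ _ k) => //.
by rewrite fineK// (maxop_fin_num p1 wA f1).
Qed.

Lemma lp_le_single (R : realType) (w : nat -> R) (p c : R) : 0 < p -> weight w ->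
  0 <= c ->
  lp_le p w (fun k => if k == 1%N then c else 0) (w 1%N `^ p^-1 * c).
Proof.
move=> p0 w0 c0 n; have w1 : 0 <= w 1%N by rewrite ltW// w0.
have [n1|n1] := leqP n 1; first by rewrite big_geq// powR_ge0.
rewrite big_ltn// big_nat big1 => [|k /andP[k1 _]]; last first.
  by rewrite gtn_eqF// normr0 powR0 ?gt_eqF// mulr0.
by rewrite addr0 eqxx ger0_norm// powRM ?powR_ge0// powRVK ?gt_eqF.
Qed.

(** The point mass at 1 has a maximal function at least 1 at the index 1, so the norm cannot vanish.
    Positivity allows division by powers of the norm. *)
Lemma opnormM_gt0 (R : realType) (w : nat -> R) (p : R) :
  1 < p -> inAp p w -> 0 < fine (opnormM p w).
Proof.
move=> p1 wA; have p0 : 0 < p by exact: lt_trans p1.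
have w1 : 0 < w 1%N by apply: wA.1.
have h := lp_le_single p0 wA.1 (@ler01 R).
have t0 : 0 < w 1%N `^ p^-1 * 1 by rewrite mulr1 powR_gt0.
have m0 : 0 <= fine (opnormM p w).
  by rewrite fine_ge0// opnormM_ge0//; exact: wA.1.
rewrite lt_neqAle m0 andbT eq_sym; apply/negP => /eqP NE.
have := lp_le_term wA.1 (lp_le_opnorm p1 wA t0 h) (leqnn 1).
rewrite NE mul0r powR0 ?gt_eqF// pmulr_rle0// leNgt powR_gt0// normr_gt0.
rewrite gt_eqF//; apply: (@lt_le_trans _ _ 1) => //.
have := avg_le_maxop (fun k => if k == 1%N then 1 else 0 : R) (leqnn 1) (leqnn 1).
rewrite -[X in (_ <= X)%E]fineK ?(maxop_fin_num p1 wA h)// lee_fin.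
by rewrite /avg big_nat1 eqxx normr1 invr1 mulr1.
Qed.

(** * The Rubio de Francia iteration *)

Lemma cvg_sum1 (R : realType) (F : nat -> nat -> R) (l : nat -> R) (n : nat) :
  (forall k, (1 <= k)%N -> F k m @[m --> \oo] --> l k)%classic ->
  (\sum_(1 <= k < n) F k m @[m --> \oo] --> \sum_(1 <= k < n) l k)%classic.
Proof.
move=> Fl; rewrite (big_nat _ _ 1).
under eq_cvg do rewrite (big_nat _ _ 1).
apply: cvg_big => [|k /andP[k1 _]]; last exact: Fl.
exact: add_continuous.
Qed.

Lemma cvg_powR (R : realType) (p l : R) (u : nat -> R) : 0 < l ->
  (u m @[m --> \oo] --> l)%classic -> (u m `^ p @[m --> \oo] --> l `^ p)%classic.
Proof.
move=> l0; apply: (@continuous_cvg _ _ _ _ _ _ (fun x : R => x `^ p)).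
by apply/differentiable_continuous/derivable1_diffP/derivable_powR; rewrite in_itv/= l0.
Qed.

Lemma sum_half_le2 (R : realType) (m : nat) : \sum_(i < m) 2^-1 ^+ i <= 2 :> R.
Proof.
suff -> : \sum_(i < m) 2^-1 ^+ i = 2 - 2 * 2^-1 ^+ m :> R.
  by rewrite gerBl mulr_ge0// exprn_ge0// invr_ge0.
elim: m => [|m IH]; first by rewrite big_ord0 expr0 mulr1 subrr.
by rewrite big_ord_recr/= IH exprS; field.
Qed.

(* Jensen's inequality for the weights [2^-i], of total mass at most 2. *)
Lemma lp_le_half_sum (R : realType) (w : nat -> R) (b : nat -> nat -> R) (p t : R)
    (m : nat) : 1 < p -> weight w -> 0 <= t ->
  (forall i k, (1 <= k)%N -> 0 <= b i k) -> (forall i, lp_le p w (b i) t) ->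
  lp_le p w (fun k => \sum_(i < m) 2^-1 ^+ i * b i k) (2 * t).
Proof.
move=> p1 w0 t0 b0 bt n; have p0 : 0 < p by exact: lt_trans p1.
have e0 i : 0 <= 2^-1 ^+ i :> R by rewrite exprn_ge0// invr_ge0.
have S0 : 0 <= \sum_(i < m) 2^-1 ^+ i :> R by rewrite sumr_ge0.
have jensen k : (1 <= k)%N -> `|\sum_(i < m) 2^-1 ^+ i * b i k| `^ p <=
    2 `^ (p - 1) * \sum_(i < m) 2^-1 ^+ i * b i k `^ p.
  move=> k1; have s0 : 0 <= \sum_(i < m) 2^-1 ^+ i * b i k.
    by rewrite sumr_ge0// => i _; rewrite mulr_ge0// b0.
  have X0 : 0 <= \sum_(i < m) 2^-1 ^+ i * b i k `^ p.
    by rewrite sumr_ge0// => i _; rewrite mulr_ge0// powR_ge0.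
  rewrite ger0_norm//.
  have := @hoelder_sum R _ (index_enum 'I_m) (fun i => 2^-1 ^+ i * b i k `^ p)
    (fun i => 2^-1 ^+ i) p^-1.
  rewrite invr_gt0 invf_lt1// => /(_ p0 p1) h.
  have {h} h : \sum_(i < m) 2^-1 ^+ i * b i k <=
     (\sum_(i < m) 2^-1 ^+ i * b i k `^ p) `^ p^-1 *
     (\sum_(i < m) 2^-1 ^+ i) `^ (1 - p^-1).
    apply: le_trans (h _ _) => [|i _|i _]//; last by rewrite mulr_ge0// powR_ge0.
    apply: ler_sum => i _; rewrite powRM ?powR_ge0// powRK ?gt_eqF ?b0// mulrAC.
    by rewrite powR_mulD ?exprn_gt0 ?invr_gt0// [p^-1 + _]addrC subrK powRr1.
  apply: le_trans (le_powR_base (ltW p0) s0 h) _.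
  rewrite powRM ?powR_ge0// powRVK ?gt_eqF// -powRrM mulrC.
  rewrite mulrBl mul1r mulVf ?gt_eqF// ler_wpM2r//.
  by apply: le_powR_base; rewrite ?S0 ?sum_half_le2// subr_ge0 ltW.
apply: (@le_trans _ _ (\sum_(1 <= k < n) 2 `^ (p - 1) *
    \sum_(i < m) 2^-1 ^+ i * (w k * b i k `^ p))).
  apply: ler_sum1 => k k1; rewrite -subr_ge0.
  have -> : \sum_(i < m) 2^-1 ^+ i * (w k * b i k `^ p) =
      w k * \sum_(i < m) 2^-1 ^+ i * b i k `^ p.
    by rewrite mulr_sumr; apply: eq_bigr => i _; rewrite mulrCA.
  by rewrite subr_ge0 mulrCA ler_pM2l ?w0// jensen.
rewrite -mulr_sumr exchange_big/= powRM//.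
have -> : 2 `^ p = 2 `^ (p - 1) * 2 :> R.
  by rewrite mulrC mulr_powRB1.
rewrite -mulrA ler_wpM2l ?powR_ge0//.
apply: le_trans (_ : _ <= (\sum_(i < m) 2^-1 ^+ i) * t `^ p) _; last first.
  by rewrite ler_wpM2r ?powR_ge0// sum_half_le2.
rewrite mulr_suml; apply: ler_sum => i _; rewrite -mulr_sumr ler_wpM2l//.
apply: le_trans (bt i n); apply: ler_sum1 => k k1.
by rewrite ger0_norm// b0.
Qed.

(** The normalised iterates [b i] all keep the norm bound [t], so [lp_le_half_sum] bounds the
    partial sums [V m] by [2 * t]. Both this bound and that on averages involve finitely many
    indices at a time, and so pass to the limit [v]. *)
Lemma rubio_de_francia (R : realType) (w h : nat -> R) (p t : R) :
  1 < p -> inAp p w -> 0 < t -> lp_le p w h t ->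
  (forall k, (1 <= k)%N -> 0 <= h k) -> (exists2 k, (1 <= k)%N & 0 < h k) ->
  exists v : nat -> R,
    [/\ weight v, forall k, (1 <= k)%N -> h k <= v k, lp_le p w v (2 * t) &
      forall k n, (1 <= k)%N -> (k <= n)%N ->
        avg v n <= 2 * fine (opnormM p w) * v k].
Proof.
move=> p1 wA t0 ht h0 [k0 k01 hk0]; have p0 : 0 < p by exact: lt_trans p1.
have w0 := wA.1; have N0 := opnormM_gt0 p1 wA.
set N := fine _ in N0 *.
pose T (f : nat -> R) k := fine (maxop f k).
pose a i := iter i T h.
have a0 i k : (1 <= k)%N -> 0 <= a i k.
  by case: i => [/h0//|i _]; rewrite fine_ge0// maxop_ge0.
have Ni i : 0 < N ^+ i by rewrite exprn_gt0.
have aT i : lp_le p w (a i) (N ^+ i * t).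
  elim: i => [|i IH]; first by rewrite expr0 mul1r.
  by rewrite exprS -mulrA; apply: lp_le_opnorm => //; rewrite mulr_gt0.
have aS i k n : (1 <= k)%N -> (k <= n)%N -> avg (a i) n <= a i.+1 k.
  move=> k1 kn; have -> : avg (a i) n = avg (fun j => `|a i j|) n.
    rewrite /avg; congr (_ * _); apply: eq_sum1 => j j1.
    by rewrite ger0_norm// a0.
  apply: (@maxop_le_avg_le _ _ k) => //.
  by rewrite fineK// (maxop_fin_num p1 wA (aT i)).
pose b i k := (N ^+ i)^-1 * a i k.
have b0 i k : (1 <= k)%N -> 0 <= b i k.
  by move=> k1; rewrite mulr_ge0 ?a0// invr_ge0 ltW.
have bt i : lp_le p w (b i) t.
  have -> : t = (N ^+ i)^-1 * (N ^+ i * t) by rewrite mulKf// gt_eqF.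
  by apply: lp_leZ (aT i); rewrite ?invr_ge0 ?mulr_ge0 ?(ltW (Ni i)) ?(ltW t0).
have bS i k n : (1 <= k)%N -> (k <= n)%N -> avg (b i) n <= N * b i.+1 k.
  move=> k1 kn; rewrite avg_mulr /b exprS.
  have -> : N * ((N * N ^+ i)^-1 * a i.+1 k) = (N ^+ i)^-1 * a i.+1 k.
    by field; rewrite !gt_eqF.
  by rewrite ler_pM2l ?invr_gt0// aS.
pose V m k := \sum_(i < m) 2^-1 ^+ i * b i k.
have e0 i : 0 < 2^-1 ^+ i :> R by rewrite exprn_gt0// invr_gt0.
have VT m : lp_le p w (V m) (2 * t) by apply: lp_le_half_sum => //; exact: ltW.
have V0 m k : (1 <= k)%N -> 0 <= V m k.
  by move=> k1; apply: sumr_ge0 => i _; rewrite mulr_ge0 ?b0// ltW.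
have Vnd k : (1 <= k)%N -> {homo V ^~ k : n m / (n <= m)%N >-> n <= m}.
  move=> k1; apply/nondecreasing_seqP => m; rewrite /V big_ord_recr/= lerDl.
  by rewrite mulr_ge0 ?b0// ltW.
(* One term of the norm bound dominates [V m k] uniformly in [m]. *)
have Vcvg k : (1 <= k)%N -> cvgn (V ^~ k).
  move=> k1; apply: nondecreasing_is_cvgn; first exact: Vnd.
  exists (((2 * t) `^ p / w k) `^ p^-1) => _ [m _ <-].
  rewrite -[leLHS](@powRK _ p) ?gt_eqF ?V0//.
  apply: le_powR_base; rewrite ?invr_ge0 ?powR_ge0 ?(ltW p0)//.
  rewrite ler_pdivlMr ?w0// mulrC -[V m k]ger0_norm ?V0//.
  exact: lp_le_term.
pose v k := limn (V ^~ k).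
have Vv k m : (1 <= k)%N -> V m k <= v k.
  by move=> k1; exact: (nondecreasing_cvgn_le (Vnd k k1) (Vcvg k k1)).
have hv k : (1 <= k)%N -> h k <= v k.
  move=> k1; apply: le_trans (Vv k 1%N k1).
  by rewrite /V big_ord1 /b !expr0 invr1 !mul1r.
have v0 k : (1 <= k)%N -> 0 <= v k by move=> k1; apply: le_trans (Vv k 0%N k1); exact: V0.
(* Averaging moves the term [i] to the term [i.+1] at the cost of [N], and [2^-i] is twice
   [2^-(i+1)]; hence the factor [2 * N] and the passage to [V m.+1]. *)
have VS m k n : (1 <= k)%N -> (k <= n)%N -> avg (V m) n <= 2 * N * v k.
  move=> k1 kn; have N20 : 0 < 2 * N by rewrite mulr_gt0.
  apply: le_trans (ler_wpM2l (ltW N20) (Vv k m.+1 k1)).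
  have -> : avg (V m) n = \sum_(i < m) 2^-1 ^+ i * avg (b i) n.
    rewrite /avg exchange_big/= mulr_sumr; apply: eq_bigr => i _.
    by rewrite -mulr_sumr mulrCA.
  rewrite /V big_ord_recl mulrDr ler_wpDl//.
    by rewrite mulr_ge0 ?(ltW N20)// mulr_ge0 ?b0// ltW.
  rewrite mulr_sumr; apply: ler_sum => i _.
  have -> : 2 * N * (2^-1 ^+ lift ord0 i * b (lift ord0 i) k) =
      2^-1 ^+ i * (N * b i.+1 k).
    by rewrite /= /bump /= add1n exprS; field.
  by rewrite ler_pM2l// bS.
have vavg k n : (1 <= k)%N -> (k <= n)%N -> avg v n <= 2 * N * v k.
  move=> k1 kn; have : (avg (V m) n @[m --> \oo] --> avg v n)%classic.
    by apply: cvgMl_tmp; apply: cvg_sum1 => j /Vcvg.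
  by move=> /cvgr_to_le; apply; apply: nearW => m; exact: VS.
(* An average reaching both [k] and [k0] is positive since [h k0] is, and it bounds [v k] from
   below. *)
have vpos k : (1 <= k)%N -> 0 < v k.
  move=> k1; have N20 : 0 < 2 * N by rewrite mulr_gt0.
  rewrite -(pmulr_rgt0 _ N20); apply: lt_le_trans (vavg k (maxn k k0) k1 (leq_maxl _ _)).
  have n1 : (1 <= maxn k k0)%N by rewrite (leq_trans k1)// leq_maxl.
  rewrite mulr_gt0 ?invr_gt0 ?ltr0n//.
  apply: (@lt_le_trans _ _ (v k0)); first exact: lt_le_trans (hv _ k01).
  rewrite (big_cat_nat _ (leqW (leq_maxr k k0)))//= (@big_ltn _ _ _ k0) ?ltnS ?leq_maxr//.
  rewrite addrCA lerDl addr_ge0// big_nat sumr_ge0// => j /andP[j1 _]; apply: v0 => //.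
  exact: leq_trans (ltnW j1).
exists v; split=> // n.
have : (\sum_(1 <= k < n) w k * `|V m k| `^ p @[m --> \oo] -->
    \sum_(1 <= k < n) w k * `|v k| `^ p)%classic.
  apply: cvg_sum1 => k k1; apply: cvgMl_tmp; apply: cvg_powR.
    by rewrite normr_gt0 gt_eqF// vpos.
  by apply: cvg_norm; exact: Vcvg.
by move=> /cvgr_to_le; apply; apply: nearW => m; exact: VT.
Qed.

(** * The weight [w v^(p - p0)] and the passage from l^p0 to l^p *)

Lemma avg_hoelder (R : realType) (a b : nat -> R) (t : R) (n : nat) :
  0 < t -> t < 1 -> (forall k, (1 <= k)%N -> 0 <= a k) ->
  (forall k, (1 <= k)%N -> 0 <= b k) -> (1 <= n)%N ->
  avg (fun k => a k `^ t * b k `^ (1 - t)) n <= avg a n `^ t * avg b n `^ (1 - t).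
Proof.
move=> t0 t1 a0 b0 n1; have n0 : 0 < n%:R^-1 :> R by rewrite invr_gt0 ltr0n.
rewrite /avg !powRM ?sum1_ge0 ?(ltW n0)// mulrACA powR_mulD// [t + _]addrC subrK.
rewrite powRr1 ?(ltW n0)// ler_pM2l//.
by apply: hoelder_sum => // k; rewrite mem_index_iota => /andP[k1 _]; auto.
Qed.

(** On [1, n] the hypothesis bounds [v] below by [avg v n / c], so [avg w0 n] gains the factor
    [c^(p0-p) (avg v n)^(-(p0-p))]. Hoelder's inequality for the dual weight yields the opposite
    power of [avg v n], and the two cancel. *)
Lemma extrapolation_weight (R : realType) (w v : nat -> R) (p p0 c : R) :
  1 < p -> p < p0 -> inAp p w -> weight v -> 0 < c ->
  (forall k n, (1 <= k)%N -> (k <= n)%N -> avg v n <= c * v k) ->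
  let w0 k := w k * v k `^ (- (p0 - p)) in
  inAp p0 w0 /\ Apc p0 w0 <= c `^ (p0 - p) * Apc p w.
Proof.
move=> p1 pp0 wA v0 c0 A1 w0; have w_gt0 := wA.1.
have d0 : 0 < p0 - p by rewrite subr_gt0.
have p10 : 0 < p - 1 by rewrite subr_gt0.
have p010 : 0 < p0 - 1 by rewrite subr_gt0 (lt_trans p1).
have w0_gt0 : weight w0 by move=> k k1; rewrite mulr_gt0 ?w_gt0// powR_gt0// v0.
apply: Ap_const_le => // n n1.
have n0 : 0 < n%:R^-1 :> R by rewrite invr_gt0 ltr0n.
have vn0 : 0 < avg v n by exact: avg_gt0.
have s0 k : (1 <= k)%N -> 0 <= dual_weight p w k by move=> _; exact: powR_ge0.
have h1 : avg w0 n <= c `^ (p0 - p) * avg v n `^ (- (p0 - p)) * avg w n.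
  rewrite -avg_mulr ler_pM2l// !(big_nat _ _ 1); apply: ler_sum => k /andP[k1].
  rewrite ltnS => kn; rewrite /w0 mulrC ler_pM2r ?w_gt0// !powRN.
  rewrite -[leRHS]invrK lef_pV2 ?posrE ?invr_gt0 ?powR_gt0 ?v0//; last first.
    by rewrite divr_gt0 ?powR_gt0.
  rewrite invf_div ler_pdivrMr ?powR_gt0// -powRM ?(ltW c0) ?(ltW (v0 k k1))//.
  by apply: le_powR_base; rewrite ?(ltW d0) ?(ltW vn0)// mulrC A1.
(* With this exponent the dual weight of [w0] is the geometric mean of the dual weight of [w] and of
   [v]. *)
pose t := (p - 1) / (p0 - 1).
have t0 : 0 < t by rewrite divr_gt0.
have t1 : t < 1 by rewrite ltr_pdivrMr// mul1r ltrD2r.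
have h2 : avg (dual_weight p0 w0) n `^ (p0 - 1) <=
    avg (dual_weight p w) n `^ (p - 1) * avg v n `^ (p0 - p).
  have E : avg (dual_weight p0 w0) n =
      avg (fun k => dual_weight p w k `^ t * v k `^ (1 - t)) n.
    rewrite /avg; congr (_ * _); apply: eq_sum1 => k k1.
    rewrite /dual_weight /w0 powRM ?powR_ge0 ?(ltW (w_gt0 k k1))// -!powRrM.
    by congr (_ `^ _ * _ `^ _); rewrite /t; field; rewrite !gt_eqF.
  rewrite E; apply: (@le_trans _ _
      ((avg (dual_weight p w) n `^ t * avg v n `^ (1 - t)) `^ (p0 - 1))).
    apply: le_powR_base; first exact: ltW.
      by apply: avg_ge0 => k _; rewrite mulr_ge0 ?powR_ge0.
    by apply: avg_hoelder => // k /v0/ltW.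
  rewrite powRM ?powR_ge0// -!powRrM le_eqVlt; apply/orP; left; apply/eqP.
  by congr (_ `^ _ * _ `^ _); rewrite /t; field; rewrite gt_eqF.
apply: le_trans (ler_pM _ _ h1 h2) _; rewrite ?powR_ge0//.
  by apply: avg_ge0 => k /w0_gt0/ltW.
have h3 := Ap_const_ge wA n1; rewrite -(ler_pM2l (powR_gt0 (p0 - p) c0)) in h3.
apply: le_trans h3; rewrite powRN le_eqVlt; apply/orP; left; apply/eqP.
set X := avg v n `^ _; have X0 : X != 0 by rewrite gt_eqF// powR_gt0.
set Y := _ `^ (p - 1); set Z := c `^ _.
by field.
Qed.

(** Hoelder's inequality with exponent [p / p0], after splitting [w f^p] as [(w v^(p-p0)
    f^p0)^(p/p0) (w v^p)^(1-p/p0)], where the powers of [v] cancel. *)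
Lemma lp_le_hoelder (R : realType) (w v f : nat -> R) (p p0 a b : R) :
  0 < p -> p < p0 -> weight w -> weight v -> 0 <= a -> 0 <= b ->
  lp_le p0 (fun k => w k * v k `^ (- (p0 - p))) f a -> lp_le p w v b ->
  lp_le p w f (a * b `^ ((p0 - p) / p0)).
Proof.
move=> p_gt0 pp0 w0 v0 a0 b0 fa vb n.
have p0_gt0 : 0 < p0 by exact: lt_trans pp0.
pose t := p / p0.
have t0 : 0 < t by rewrite divr_gt0.
have t1 : t < 1 by rewrite ltr_pdivrMr// mul1r.
have t1' : 0 < 1 - t by rewrite subr_gt0.
have W0 k : (1 <= k)%N -> 0 <= w k * v k `^ (- (p0 - p)) * `|f k| `^ p0.
  by move=> k1; rewrite !mulr_ge0 ?powR_ge0// ltW// w0.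
have V0 k : (1 <= k)%N -> 0 <= w k * `|v k| `^ p.
  by move=> k1; rewrite !mulr_ge0 ?powR_ge0// ltW// w0.
apply: (@le_trans _ _ (\sum_(1 <= k < n)
    (w k * v k `^ (- (p0 - p)) * `|f k| `^ p0) `^ t * (w k * `|v k| `^ p) `^ (1 - t))).
  apply: ler_sum1 => k k1; rewrite le_eqVlt; apply/orP; left; apply/eqP.
  have wk := w0 k k1; have vk := v0 k k1.
  rewrite (gtr0_norm vk) !powRM ?mulr_ge0 ?powR_ge0 ?(ltW wk)// -!powRrM.
  have -> : p0 * t = p by rewrite /t mulrC divfK// gt_eqF.
  set F := `|f k| `^ p.
  transitivity (w k `^ (t + (1 - t)) *
      v k `^ (- (p0 - p) * t + p * (1 - t)) * F).
    have -> : t + (1 - t) = 1 by ring.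
    have -> : - (p0 - p) * t + p * (1 - t) = 0 by rewrite /t; field; rewrite gt_eqF.
    by rewrite powRr0 mulr1 powRr1// ltW.
  rewrite -!powR_mulD//; ring.
apply: le_trans (hoelder_sum t0 t1 _ _) _.
- by move=> k; rewrite mem_index_iota => /andP[/W0].
- by move=> k; rewrite mem_index_iota => /andP[/V0].
rewrite powRM ?powR_ge0//; apply: ler_pM; rewrite ?powR_ge0//.
  apply: le_trans (le_powR_base (ltW t0) _ (fa n)) _; first exact: sum1_ge0.
  by rewrite -powRrM /t [p0 * _]mulrC divfK// gt_eqF.
apply: le_trans (le_powR_base (ltW t1') _ (vb n)) _; first exact: sum1_ge0.
rewrite -!powRrM.
suff -> : p * (1 - t) = (p0 - p) / p0 * p by [].
by rewrite /t; field; rewrite gt_eqF.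
Qed.

(** * Extrapolation from the exponent p0 down to p *)

Theorem theorem3p1 (R : realType) (p p0 : R) (f g : nat -> R) (phi : R -> R) :
  1 < p -> p < p0 ->
  (forall k : nat, (1 <= k)%N -> 0 <= f k) ->
  (forall k : nat, (1 <= k)%N -> 0 <= g k) ->
  (forall x : R, 1 <= x -> 0 < phi x) ->
  (forall x y : R, 1 <= x -> x <= y -> phi x <= phi y) ->
  (forall w0 : nat -> R, inAp p0 w0 ->
     (lpnorm p0 w0 f <= (phi (Apc p0 w0))%:E * lpnorm p0 w0 g)%E) ->
  forall w : nat -> R, inAp p w -> (lpnorm p w f < +oo)%E ->
  (lpnorm p w f <=
     (2 `^ ((p0 - p) / p0) *
      phi ((2 * fine (opnormM p w)) `^ (p0 - p) * Apc p w))%:E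
     * lpnorm p w g)%E.
Proof.
move=> p1 pp0 f0 g0 phi_gt0 phi_le Hfg w wA _.
have p_gt0 : 0 < p by exact: lt_trans p1.
have p01 : 1 < p0 by exact: lt_trans pp0.
have p0_gt0 : 0 < p0 by exact: lt_trans pp0.
have w_gt0 := wA.1; have N0 := opnormM_gt0 p1 wA.
have w1_gt0 : 0 < w 1%N `^ p^-1 * 1 by rewrite mulr1 powR_gt0// w_gt0.
set N := fine _ in N0 *; set X := _ `^ _ * Apc p w; set d := (p0 - p) / p0.
have N20 : 0 < 2 * N by rewrite mulr_gt0.
have weights h t : 0 < t -> lp_le p w h t -> (forall k, (1 <= k)%N -> 0 <= h k) ->
    (exists2 k, (1 <= k)%N & 0 < h k) ->
    exists v, [/\ weight v, forall k, (1 <= k)%N -> h k <= v k, lp_le p w v (2 * t),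
      inAp p0 (fun k => w k * v k `^ (- (p0 - p))) &
      Apc p0 (fun k => w k * v k `^ (- (p0 - p))) <= X].
  move=> t0 ht h0 hpos.
  have [v [v0 hv vt vA]] := rubio_de_francia p1 wA t0 ht h0 hpos.
  by have [w0A w0X] := extrapolation_weight p1 pp0 wA v0 N20 vA; exists v.
(* The bound [s] on [g] in l^p0(w0) is kept separate from [t], so that [g = 0] is covered by [s = 0]
   and a majorant unrelated to [g]. *)
have core v t s : weight v -> 0 < t -> lp_le p w v (2 * t) ->
    inAp p0 (fun k => w k * v k `^ (- (p0 - p))) ->
    Apc p0 (fun k => w k * v k `^ (- (p0 - p))) <= X -> 0 <= s ->
    lp_le p0 (fun k => w k * v k `^ (- (p0 - p))) g s ->
    lp_le p w f (phi X * s * (2 * t) `^ d).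
  set w0 := fun k => _ => v0 t0 vt w0A w0X s0 gs.
  have w01 : 1 <= Apc p0 w0 by exact: Apc_ge1.
  have phiX := phi_gt0 X (le_trans w01 w0X).
  have phis0 : 0 <= phi X * s by rewrite mulr_ge0// ltW.
  apply: (@lp_le_hoelder _ _ v _ _ p0) => //; first by rewrite mulr_ge0 ?(ltW t0).
  apply/lpnorm_leP => //; first exact: w0A.1.
  apply: le_trans (Hfg _ w0A) _; rewrite EFinM.
  apply: lee_pmul; rewrite ?lee_fin ?(ltW (phi_gt0 _ w01)) ?phi_le//.
    exact: poweR_ge0.
  by apply/lpnorm_leP => //; exact: w0A.1.
(* The majorant of the point mass at 1: its weight shows [1 <= X], whence [phi X > 0], and it serves
   again when [g] vanishes. *)
have [k _||v1 [v10 _ v1t w1A w1X]] :=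
    weights _ _ w1_gt0 (lp_le_single p_gt0 w_gt0 ler01).
- by case: ifP.
- by exists 1%N.
have X1 : 1 <= X by apply: le_trans w1X; exact: Apc_ge1.
have phiX := phi_gt0 X X1.
have C0 : 0 < 2 `^ d * phi X by rewrite mulr_gt0// powR_gt0.
have [[k k1 gk]|gneg] := pselect (exists2 k, (1 <= k)%N & 0 < g k); last first.
  have gE k : (1 <= k)%N -> g k = 0.
    move=> k1; apply/eqP; rewrite eq_le g0// andbT leNgt; apply/negP => gk.
    by apply: gneg; exists k.
  have f00 : lp_le p w f 0.
    rewrite -(mul0r ((2 * (w 1%N `^ p^-1 * 1)) `^ d)) -(mulr0 (phi X)).
    apply: (core v1 _ 0 v10 w1_gt0 v1t w1A w1X (lexx 0)) => n.
    rewrite big_nat big1 ?powR_ge0// => k /andP[k1 _].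
    by rewrite gE// normr0 powR0 ?gt_eqF// mulr0.
  apply: (@le_trans _ _ 0%:E); first exact/lpnorm_leP.
  by rewrite mule_ge0 ?poweR_ge0// lee_fin ltW.
have : (0 <= lpnorm p w g)%E by exact: poweR_ge0.
(* If the norm of [g] is infinite, so is the right side, its constant being positive. *)
case E : (lpnorm p w g) => [t| |]//; last by rewrite gt0_muley ?leey.
rewrite lee_fin => t_ge0.
have gt : lp_le p w g t by apply/lpnorm_leP => //; rewrite E.
have t0 : 0 < t.
  rewrite lt_neqAle t_ge0 andbT eq_sym; apply/eqP => t0.
  have := lp_le_term w_gt0 gt k1; rewrite t0 powR0 ?gt_eqF// leNgt.
  by rewrite mulr_gt0 ?w_gt0// powR_gt0// normr_gt0 gt_eqF.
have [|v [v0 gv vt w0A w0X]] := weights g t t0 gt g0; first by exists k.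
(* Since [g <= v], [v^(-(p0-p)) g^p0 <= g^p]; so the p0-th power of the norm in l^p0(w0) is at most
   [t^p]. *)
have gs : lp_le p0 (fun k => w k * v k `^ (- (p0 - p))) g (t `^ (p / p0)).
  move=> n; rewrite -powRrM divfK ?gt_eqF//; apply: le_trans (gt n).
  apply: ler_sum1 => j j1; have vj := v0 j j1.
  rewrite -mulrA ler_pM2l ?w_gt0// powRN mulrC ler_pdivrMr ?powR_gt0//.
  rewrite (ger0_norm (g0 j j1)).
  have [->|gj] := eqVneq (g j) 0; first by rewrite !powR0 ?gt_eqF// mul0r.
  have {}gj : 0 < g j by rewrite lt_neqAle eq_sym gj g0.
  have -> : g j `^ p0 = g j `^ p * g j `^ (p0 - p).
    by rewrite powR_mulD// [p + _]addrC subrK.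
  rewrite ler_pM2l ?powR_gt0//; apply: le_powR_base; rewrite ?(ltW gj) ?gv//.
  by rewrite subr_ge0 ltW.
rewrite -EFinM; apply/lpnorm_leP => //; first by rewrite mulr_ge0// ltW.
(* The powers of [t] recombine because [p / p0 + d = 1]; the factor [2 ^ d] stems from the norm
   [2 * t] of the majorant. *)
have -> : 2 `^ d * phi X * t = phi X * t `^ (p / p0) * (2 * t) `^ d.
  rewrite powRM// mulrACA powR_mulD//.
  have -> : p / p0 + d = 1 by rewrite /d; field; rewrite gt_eqF.
  by rewrite powRr1// [phi X * _]mulrC.
exact: (core v _ _ v0 t0 vt w0A w0X (powR_ge0 _ _) gs).
Qed.
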